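(* For any system $F$ of $\mathbb{F}_2$-linear equations that is an $(r,s+3)$-boundary expander, $\mathrm{depth}_{\mathsf{sCP}}(F)\ge rs/2$.
   Context: The constraint-variable graph $G_F=(F\cup V,E)$ is bipartite with a vertex for each equation and each variable, and an edge $(C,x)$ if $x$ occurs in $C$. For a bipartite graph $G=(U\cup V,E)$ and $W\subseteq U$, $\Gamma(v)$ is the neighbourhood of $v$, the boundary is $\delta(W):=\{v\in V:|\Gamma(v)\cap W|=1\}$, and the boundary expansion of $W$ is $|\delta(W)|/|W|$. $G$ is an $(r,s)$-boundary expander if every $W\subseteq U$ with $|W|\le r$ has boundary expansion at least $s$; $F$ is an $(r,s)$-boundary expander if $G_F$ is. $\mathrm{depth}_{\mathsf{sCP}}(F)$ is the minimum depth of a Semantic Cutting Planes refutation of the CNF encoding of $F$ (each equation written as clauses ruling out its falsifying assignments, translated into linear inequalities in the standard way). Semantic Cutting Planes: each line is an input inequality or is deduced from at most two earlier lines by the rule that every $\{0,1\}$ assignment satisfying the premises satisfies the conclusion; a refutation derives an unsatisfiable inequality; depth is the longest path in the proof DAG. *)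

(* Defs.v *)
From mathcomp Require Import classical_sets reals constructive_ereal ereal.
From mathcomp Require Import all_boot all_order all_algebra.

Set Implicit Arguments.
Unset Strict Implicit.
Unset Printing Implicit Defensive.

Import Order.TTheory GRing.Theory Num.Theory.
Local Open Scope ring_scope.

(* A bipartite graph on U + V is given by its edge relation e : U -> V -> bool. *)
Section BoundaryExpansion.
Variables (U V : finType) (e : U -> V -> bool).

Definition neighbourhood (v : V) : {set U} := [set u | e u v].

Definition boundary (W : {set U}) : {set V} :=
  [set v | #|neighbourhood v :&: W| == 1%N].

Definition boundary_expansion (R : realType) (W : {set U}) : R :=
  #|boundary W|%:R / #|W|%:R.

(* W = set0 is excluded: its ratio would be 0 / 0, which evaluates to 0 here. *)
Definition boundary_expander (R : realType) (r : nat) (s : R) : Prop :=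
  forall W : {set U}, W != set0 -> (#|W| <= r)%N ->
    s <= boundary_expansion R W.

End BoundaryExpansion.

(* Equation i of the system reads \sum_x eq_coef i x * x = eq_rhs i. *)
Record linsys (m n : nat) := LinSys {
  eq_coef : 'M['F_2]_(m, n);
  eq_rhs : 'cV['F_2]_m
}.

Definition assignment (n : nat) := {ffun 'I_n -> bool}.

Section LinearSystem.
Variables (m n : nat) (F : linsys m n).

Definition occurs (i : 'I_m) (x : 'I_n) : bool := eq_coef F i x != 0.

Definition sat_eq (i : 'I_m) (a : assignment n) : bool :=
  \sum_(x < n) eq_coef F i x * (a x : nat)%:R == eq_rhs F i 0.

Definition linsys_expander (R : realType) (r : nat) (s : R) : Prop :=
  boundary_expander occurs r s.

End LinearSystem.

(* The literal (x, true) is the variable x, and (x, false) is its negation. *)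
Definition clause (n : nat) := {set 'I_n * bool}.

Section CNFEncoding.
Variables (m n : nat) (F : linsys m n).

(* The clause over the variables of equation i that is falsified exactly by
   the assignments agreeing with a on these variables. *)
Definition ruling_out (i : 'I_m) (a : assignment n) : clause n :=
  [set l | occurs F i l.1 && (l.2 == ~~ a l.1)].

Definition cnf_of : {set clause n} :=
  [set C | [exists i : 'I_m, exists a : assignment n,
              ~~ sat_eq F i a && (C == ruling_out i a)]].

End CNFEncoding.

(* The inequality \sum_x ineq_coef x * x >= ineq_rhs. *)
Record ineq (n : nat) := Ineq {
  ineq_coef : 'rV[int]_n;
  ineq_rhs : int
}.

Definition sat_ineq (n : nat) (L : ineq n) (a : assignment n) : bool :=
  ineq_rhs L <= \sum_(x < n) ineq_coef L 0 x * (a x : nat)%:R.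

(* \sum_((x, true) in C) x + \sum_((x, false) in C) (1 - x) >= 1, with the
   constants moved to the right-hand side. *)
Definition ineq_of_clause (n : nat) (C : clause n) : ineq n :=
  Ineq (\row_x (((x, true) \in C : nat)%:R - ((x, false) \in C : nat)%:R))
       (1 - #|[set x | (x, false) \in C]|%:R).

(* The proof DAG has the lines as vertices and an edge from each premise of an
   inference to its conclusion. *)
Record sCP_dag (n : nat) := SCPDag {
  nlines : nat;
  line : 'I_nlines -> ineq n;
  premises : 'I_nlines -> {set 'I_nlines}
}.

Section SemanticCuttingPlanes.
Variables (n : nat) (P : sCP_dag n).

Definition is_input (inputs : {set clause n}) (i : 'I_(nlines P)) : Prop :=
  premises i = set0 /\ exists2 C, C \in inputs & line i = ineq_of_clause C.

(* With an empty set of premises the rule derives the inequalities valid on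
   {0,1}^n, such as 0 <= x and x <= 1. *)
Definition is_deduced (i : 'I_(nlines P)) : Prop :=
  [/\ forall j, j \in premises i -> (j < i)%N,
      (#|premises i| <= 2)%N
    & forall a : assignment n,
        (forall j, j \in premises i -> sat_ineq (line j) a) ->
        sat_ineq (line i) a].

Definition sCP_proof (inputs : {set clause n}) : Prop :=
  forall i, is_input inputs i \/ is_deduced i.

Definition sCP_refutation (inputs : {set clause n}) : Prop :=
  sCP_proof inputs /\
  exists i, forall a : assignment n, ~~ sat_ineq (@line _ P i) a.

Definition dag_edge (j i : 'I_(nlines P)) : bool := j \in premises i.

(* The largest number of edges on a path; a path in the DAG of a proof visits
   no line twice, so that its number of edges is less than nlines P. *)
Definition dag_depth : nat :=
  \max_(k < nlines P | [exists i, exists p : k.-tuple 'I_(nlines P),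
                          path dag_edge i p]) k.

End SemanticCuttingPlanes.

(* The infimum is +oo when F is satisfiable and hence has no refutation. *)
Definition depth_sCP (R : realType) (m n : nat) (F : linsys m n) : \bar R :=
  ereal_inf [set d | exists2 P : sCP_dag n,
                       sCP_refutation P (cnf_of F) &
                       d = ((dag_depth P)%:R)%:E]%classic.

(* Main.v *)
(* Follow a path of the refutation from its unsatisfiable line back to an input,
   keeping a point of {0, 1/2, 1}^n that falsifies the current line.  If a line
   is falsified there, a linear-programming (discrepancy) argument shows that
   fixing at most two of the half-integral variables falsifies some premise.
   After each step, a maximal set W of at most r equations whose boundary
   outside the fixed variables J has size at most 3|W| is satisfied by integral
   values: before the step every further set of equations has at least four
   boundary variables left, hence at least two after it, so these equations
   force no single variable, the current point is the average of their
   solutions, and one solution keeps the line falsified.  An input clause can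
   only be falsified once |W| = r, whereas expansion gives s|W| <= |J| and |J|
   is at most twice the number of steps. *)
Require Import Defs.
From mathcomp Require Import classical_sets reals constructive_ereal ereal.
From mathcomp Require Import all_boot all_order all_algebra.
From mathcomp Require Import zify ring lra.

Set Implicit Arguments.
Unset Strict Implicit.
Unset Printing Implicit Defensive.

Import Order.TTheory GRing.Theory Num.Theory.
Local Open Scope ring_scope.

(** * Vertices of sections of the cube, and discrepancy *)

Section Discrepancy.
Variables (n p : nat).

(** More than [p] rows of width [p] are dependent; the dependency among the rows in [S] is extended
    by zero. *)
Lemma left_kernel_supported (K : fieldType) (A : 'M[K]_(n, p))
    (S : {set 'I_n}) :
  (p < #|S|)%N ->
  exists c : 'rV[K]_n, [/\ c != 0, c *m A = 0 & forall i, i \notin S -> c 0 i = 0].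
Proof.
move=> ltpS; pose B := rowsub (enum_val : 'I_#|S| -> 'I_n) A.
have : kermx B != 0.
  by rewrite -mxrank_eq0 mxrank_ker subn_eq0 -ltnNge (leq_ltn_trans (rank_leq_col B)).
case/rowV0Pn=> u /sub_kermxP uB0 u0.
pose Z : 'M[K]_(#|S|, n) := rowsub (enum_val : 'I_#|S| -> 'I_n) 1%:M.
have cE k : (u *m Z) 0 (enum_val k) = u 0 k.
  rewrite mxE (bigD1 k) //= !mxE eqxx mulr1 big1 ?addr0 // => j jk.
  by rewrite !mxE (inj_eq enum_val_inj) (negPf jk) mulr0.
exists (u *m Z); split.
- apply: contraNneq u0 => c0; apply/eqP/rowP => k.
  by rewrite -cE c0 !mxE.
- by rewrite -mulmxA mul_rowsub_mx mul1mx.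
- move=> i iS; rewrite mxE big1 // => k _.
  rewrite !mxE; case: eqP => [ki|_]; last by rewrite mulr0.
  by rewrite -ki enum_valP in iS.
Qed.

Lemma push_to_boundary (K : realFieldType) (x c : 'rV[K]_n) :
  c != 0 -> (forall i, `|x 0 i| <= 1) ->
  exists t, (forall i, `|(x + t *: c) 0 i| <= 1) /\
    exists2 i, c 0 i != 0 & `|(x + t *: c) 0 i| = 1.
Proof.
case/rV0Pn=> i0 ci0 x1.
(* [f i] is the time at which coordinate [i], moving along [c], reaches the face it heads for; the
   earliest such time is taken. *)
pose f i := (1 - Num.sg (c 0 i) * x 0 i) / `|c 0 i|.
case: (@arg_minP _ _ _ i0 (fun i => c 0 i != 0) f ci0) => k ck kmin.
have sgx i : `|Num.sg (c 0 i) * x 0 i| <= 1.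
  rewrite normrM; case: (eqVneq (c 0 i) 0) => [->|ci]; first by rewrite sgr0 normr0 mul0r ler01.
  by rewrite normr_sg ci mul1r.
have fk i : c 0 i != 0 -> f i * `|c 0 i| = 1 - Num.sg (c 0 i) * x 0 i.
  by move=> ci; rewrite /f divfK // normr_eq0.
have E i : c 0 i != 0 -> `|(x + f k *: c) 0 i| = `|Num.sg (c 0 i) * x 0 i + f k * `|c 0 i| |.
  move=> ci; rewrite !mxE.
  rewrite -[LHS]mul1r -[in LHS](_ : `|Num.sg (c 0 i)| = 1); last by rewrite normr_sg ci.
  by rewrite -normrM mulrDr mulrCA -normrEsg.
have f0 : 0 <= f k.
  rewrite /f divr_ge0 // subr_ge0; exact: le_trans (ler_norm _) (sgx k).
exists (f k); split.
  move=> i; case: (eqVneq (c 0 i) 0) => [ci|ci]; first by rewrite !mxE ci mulr0 addr0.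
  rewrite E //; have := sgx i; rewrite !ler_norml => /andP[h1 h2].
  have h3 : f k * `|c 0 i| <= f i * `|c 0 i| by rewrite ler_wpM2r // kmin.
  have h4 : 0 <= f k * `|c 0 i| by rewrite mulr_ge0.
  rewrite fk // in h3.
  apply/andP; split; lra.
by exists k => //; rewrite E // fk // addrC subrK normr1.
Qed.

Definition fractional (K : realFieldType) (x : 'rV[K]_n) : {set 'I_n} :=
  [set i | `|x 0 i| < 1].

(* A vertex of the polytope cut out of the cube by p equations has at most p
   coordinates off the boundary of the cube. *)
Lemma few_fractional (K : realFieldType) (A : 'M[K]_(n, p)) :
  exists x : 'rV[K]_n, [/\ x *m A = 0, forall i, `|x 0 i| <= 1 &
    (#|fractional x| <= p)%N].
Proof.
suff H k (x : 'rV[K]_n) : x *m A = 0 -> (forall i, `|x 0 i| <= 1) ->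
    (#|fractional x| <= k)%N ->
    exists x : 'rV[K]_n, [/\ x *m A = 0, forall i, `|x 0 i| <= 1 &
      (#|fractional x| <= p)%N].
  apply: (H _ 0 _ _ (leqnn _)); first by rewrite mul0mx.
  by move=> i; rewrite mxE normr0 ler01.
elim: k x => [|k IH] x xA x1 xk.
  by exists x; split=> //; apply: leq_trans xk _.
case: (leqP #|fractional x| p) => [le|]; first by exists x.
(* Moving along a kernel vector supported on the fractional coordinates keeps the equations and
   makes at least one more coordinate integral. *)
case/(@left_kernel_supported _ A) => c [c0 cA cS].
have [t [y1 [i ci yi]]] := push_to_boundary c0 x1.
apply: (IH (x + t *: c)) => //; first by rewrite mulmxDl -scalemxAl xA cA scaler0 addr0.
rewrite -ltnS; apply: leq_trans xk; apply: proper_card.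
apply/properP; split.
  apply/subsetP => j yj; apply/negPn/negP => jS.
  by move: yj; rewrite inE !mxE cS // mulr0 addr0 => xj; rewrite inE xj in jS.
exists i; last by rewrite [_ \in _]inE yi ltxx.
by apply: contraNT ci => /cS ->.
Qed.

(** Take the signs of a vertex [x] balancing all [p] vectors. Rounding changes only the at most [p]
    fractional coordinates, each by at most 1, and the sum weighted by [x] vanishes. *)
Lemma discrepancy (v : 'I_p -> 'I_n -> int) (E : {set 'I_n}) :
  exists eps : 'I_n -> bool, exists F : {set 'I_n},
    [/\ F \subset E, (#|F| <= p)%N &
      forall q, `|\sum_(i in E) (-1) ^+ eps i * v q i| <= \sum_(i in F) `|v q i|].
Proof.
pose A : 'M[rat]_(n, p) := \matrix_(i, q) (if i \in E then (v q i)%:~R else 0).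
have [x [xA x1 xp]] := few_fractional A.
pose G := fractional x.
exists (fun i => x 0 i < 0), (E :&: G); split.
- exact: subsetIl.
- by apply: leq_trans xp; rewrite subset_leq_card // subsetIr.
move=> q; rewrite -(ler_int rat) intr_norm !rmorph_sum /=.
under eq_bigr do rewrite rmorphM rmorphXn rmorphN1.
under [X in _ <= X]eq_bigr do rewrite intr_norm.
have sA : \sum_(i in E) x 0 i * (v q i)%:~R = 0.
  have := congr1 (fun M : 'rV_p => M 0 q) xA; rewrite !mxE => xA0; apply: etrans xA0.
  rewrite [LHS]big_mkcond; apply: eq_bigr => i _; rewrite mxE.
  by case: ifP; rewrite ?mulr0.
rewrite -[X in `|X|]subr0 -[X in _ - X]sA -sumrB.
apply: le_trans (ler_norm_sum _ _ _) _.
rewrite [X in _ <= X](_ : _ = \sum_(i in E | i \in G) `|(v q i)%:~R|); last first.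
  by apply: eq_bigl => i; rewrite in_setI.
rewrite [X in _ <= X]big_mkcondr /=; apply: ler_sum => i _.
rewrite -mulrBl normrM.
have := x1 i; rewrite inE ler_norml => /andP[h1 h2].
case: ifP => h.
  apply: ler_piMl; first exact: normr_ge0.
  by case: ltP => h3; rewrite ?expr1 ?expr0 ler_norml; apply/andP; split; lra.
suff -> : (-1) ^+ (x 0 i < 0)%R - x 0 i = 0 :> rat by rewrite normr0 mul0r.
move/negbT: h; rewrite -leNgt => h; move: h.
by case: ltP => h3; rewrite ?expr1 ?expr0; [rewrite ltr0_norm|rewrite ger0_norm] => // h; lra.
Qed.

End Discrepancy.

(** * Arithmetic over ['F_2] and boundaries of unions *)

Lemma addF2_neq (x y z : 'F_2) : x != y -> z != 0 -> x + z = y.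
Proof.
case: x y z => [[|[|]] // ?] [[|[|]] // ?] [[|[|]] // ?] //= _ _; exact: ord_inj.
Qed.

Definition xor_assignment (n : nat) (a u : assignment n) : assignment n :=
  [ffun x => a x (+) u x].

Lemma xor_assignmentK n (u : assignment n) :
  involutive (fun a => xor_assignment a u).
Proof. by move=> a; apply/ffunP => x; rewrite !ffunE addbK. Qed.

Section BoundaryGraph.
Variables (U V : finType) (e : U -> V -> bool).

Definition neighbours (W : {set U}) : {set V} :=
  [set v | [exists u in W, e u v]].

Lemma neighboursS (W1 W2 : {set U}) :
  W1 \subset W2 -> neighbours W1 \subset neighbours W2.
Proof.
move=> /subsetP sW; apply/subsetP => v; rewrite !inE => /existsP[u /andP[uW euv]].
by apply/existsP; exists u; rewrite sW.
Qed.

Lemma boundaryU (W1 W2 : {set U}) :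
  boundary e (W1 :|: W2) \subset
    boundary e W1 :|: (boundary e W2 :\: neighbours W1).
Proof.
apply/subsetP => v; rewrite !inE => /cards1P[u Nu].
have Nw w : e w v -> w \in W1 :|: W2 -> w = u.
  by move=> ew wW; apply/set1P; rewrite -Nu 2!inE ew wW.
have : u \in neighbourhood e v :&: (W1 :|: W2) by rewrite Nu set11.
rewrite !inE => /andP[euv uW].
case: (boolP (u \in W1)) => uW1.
  apply/orP; left; apply/cards1P; exists u; apply/setP => w; rewrite !inE.
  apply/andP/eqP => [[ew wW]|-> //]; by apply: Nw; rewrite ?inE ?wW.
rewrite (negPf uW1) /= in uW.
apply/orP; right; apply/andP; split.
  apply/existsP => -[w /andP[wW1 ew]].
  by move: uW1; rewrite -(Nw w) ?inE ?wW1.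
apply/cards1P; exists u; apply/setP => w; rewrite !inE.
apply/andP/eqP => [[ew wW]|-> //]; by apply: Nw; rewrite ?inE ?wW ?orbT.
Qed.

End BoundaryGraph.

(** * Solving equations through boundary variables *)

Section LinearSystem.
Variables (m n : nat) (F : linsys m n).
Local Notation occ := (occurs F).
Local Notation bd := (boundary occ).
Implicit Types (a u : assignment n) (i : 'I_m) (x : 'I_n).

Definition eq_lhs i u := \sum_(x < n) eq_coef F i x * (u x : nat)%:R.

Lemma eq_lhs_xor i a u : eq_lhs i (xor_assignment a u) = eq_lhs i a + eq_lhs i u.
Proof.
rewrite /eq_lhs -big_split /=; apply: eq_bigr => x _; rewrite -mulrDr; congr (_ * _).
by rewrite ffunE; case: (a x); case: (u x); apply/val_inj.
Qed.

Lemma eq_sat_eq i a u :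
  (forall x, occ i x -> a x = u x) -> sat_eq F i a = sat_eq F i u.
Proof.
move=> ab; rewrite /sat_eq; congr (_ == _); apply: eq_bigr => x _.
case: (boolP (occ i x)) => [/ab-> //|]; rewrite /occurs negbK => /eqP->.
by rewrite !mul0r.
Qed.

(* A set of equations all of whose nonempty subsets have a boundary in Y is
   triangular with respect to the variables in Y. *)
Lemma solvable_on (T : {set 'I_m}) (Y : {set 'I_n}) (c : 'I_m -> 'F_2) :
  (forall W : {set 'I_m}, W \subset T -> W != set0 -> bd W :&: Y != set0) ->
  exists u : assignment n, (forall x, x \notin Y -> u x = false) /\
    forall i, i \in T -> eq_lhs i u = c i.
Proof.
have [k] := ubnP #|T|; elim: k T => // k IH T; rewrite ltnS => Tk bdT.
have [->|T0] := eqVneq T set0.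
  by exists [ffun=> false]; split=> [x _|i]; [rewrite ffunE|rewrite inE].
have /set0Pn[v] := bdT _ (subxx _) T0.
rewrite !inE => /andP[/cards1P[i Ni] vY].
have Tv j : (j \in T) && occ j v = (j == i).
  by have := in_set1 j i; rewrite -Ni !inE => <-; rewrite andbC.
have /andP[iT iv] : (i \in T) && occ i v by rewrite Tv.
have [||u [uY uT]] := IH (T :\ i).
- by move: Tk; rewrite (cardsD1 i T) iT add1n.
- by move=> W WT; apply: bdT; apply: subset_trans WT (subsetDl _ _).
case: (eqVneq (eq_lhs i u) (c i)) => [ui|ui].
  exists u; split=> // j jT; case: (eqVneq j i) => [-> //|ji].
  by apply: uT; rewrite !inE ji.
(* Flipping [v] repairs equation [i] and disturbs no other equation of [T], since [v] occurs in none
   of them. *)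
pose d : assignment n := [ffun x => x == v].
have dE j : eq_lhs j d = eq_coef F j v.
  rewrite /eq_lhs (bigD1 v) //= ffunE eqxx mulr1 big1 ?addr0 // => x /negPf xv.
  by rewrite ffunE xv mulr0.
exists (xor_assignment u d); split=> [x xY|j jT].
  rewrite !ffunE uY //=; apply: contraNF xY => /eqP->; exact: vY.
rewrite eq_lhs_xor dE; case: (eqVneq j i) => [->|ji].
  exact: addF2_neq.
have := Tv j; rewrite jT (negPf ji) /= => /negbFE/eqP->.
by rewrite addr0 uT // !inE ji.
Qed.

(* Twice the value of the point that is 1/2 on E and agrees with a elsewhere. *)
Definition half_point (a : assignment n) (E : {set 'I_n}) (x : 'I_n) : int :=
  if x \in E then 1 else (2 * a x)%:R.

Definition half_value (L : ineq n) (a : assignment n) (E : {set 'I_n}) : int :=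
  \sum_(x < n) ineq_coef L 0 x * half_point a E x.

Definition falsified_at (L : ineq n) (a : assignment n) (E : {set 'I_n}) : bool :=
  half_value L a E < 2 * ineq_rhs L.

(* If no nonempty subset of T has fewer than two boundary variables in E, then
   T forces no variable in E, so that the point (a, E) is the average of the
   solutions of T that agree with a off E. *)
Lemma fix_solution (L : ineq n) (T : {set 'I_m}) a (E E' : {set 'I_n}) :
  E' \subset E ->
  (forall W : {set 'I_m}, W \subset T -> W != set0 -> (1 < #|bd W :&: E|)%N) ->
  falsified_at L a E ->
  exists b : assignment n, [/\ forall x, x \notin E -> b x = a x,
    forall i, i \in T -> sat_eq F i b & falsified_at L b E'].
Proof.
move=> sE bdT fa.
pose A := [set b : assignment n | [forall x, (x \notin E) ==> (b x == a x)] &&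
                   [forall i in T, sat_eq F i b]].
have AE b x : b \in A -> x \notin E -> b x = a x.
  by rewrite inE => /andP[/forallP/(_ x)/implyP h _] /h/eqP.
have [b0 [b0E b0T]] : exists u : assignment n, (forall x, x \notin E -> u x = false) /\
    forall i, i \in T -> eq_lhs i u = eq_rhs F i 0 - eq_lhs i a.
  apply: solvable_on => W WT W0; rewrite -card_gt0; exact: ltnW (bdT W WT W0).
have A0 : (0 < #|A|)%N.
  apply/card_gt0P; exists (xor_assignment a b0); rewrite inE; apply/andP; split.
    by apply/forallP => x; apply/implyP => xE; rewrite ffunE b0E // addbF.
  apply/forallP => i; apply/implyP => iT.
  by rewrite /sat_eq -/(eq_lhs _ _) eq_lhs_xor b0T // addrC subrK.
have halfA x : x \in E -> (\sum_(b in A) 2 * b x = #|A|)%N.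
  move=> xE.
  (* Two boundary variables in [E] leave one in [E :\ x], so the homogeneous system has a solution
     [w], zero off [E], with [w x = 1]. *)
  have [|u [uE uT]] := @solvable_on T (E :\ x) (fun i => - eq_coef F i x).
    move=> W WT W0; rewrite setIDA -card_gt0.
    by have := bdT W WT W0; rewrite (cardsD1 x); case: (_ \in _) => // /ltnW.
  pose w : assignment n := [ffun y => (y == x) || u y].
  have wT i : i \in T -> eq_lhs i w = 0.
    move=> iT; have := uT i iT; rewrite /eq_lhs (bigD1 x) //= uE ?inE ?eqxx // mulr0 add0r.
    move=> h; rewrite (bigD1 x) //= ffunE eqxx /= mulr1.
    rewrite [X in _ + X](_ : _ = - eq_coef F i x) ?subrr // -h.
    by apply: eq_bigr => y /negPf yx; rewrite ffunE yx.
  have wA b : (xor_assignment b w \in A) = (b \in A).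
    rewrite !inE; congr (_ && _); apply: eq_forallb => z.
      case: (boolP (z \in E)) => //= zE; rewrite !ffunE uE ?orbF; last first.
        by rewrite !inE (negPf zE) andbF.
      by rewrite (_ : z == x = false) ?addbF //; apply: contraNF zE => /eqP->.
    case: (boolP (z \in T)) => //= zT.
    by rewrite /sat_eq -!/(eq_lhs _ _) eq_lhs_xor wT // addr0.
  (* Adding [w] permutes [A] and flips [x], so [x] is true in exactly half of [A]. *)
  have sA : (\sum_(b in A) (b x : nat) = \sum_(b in A) (~~ b x : nat))%N.
    rewrite (reindex_inj (inv_inj (xor_assignmentK w))) /=.
    by apply: eq_big => b; rewrite ?wA // => _; rewrite !ffunE eqxx addbT.
  rewrite -big_distrr /= mul2n -addnn {2}sA -big_split /= -sum1_card.
  by apply: eq_bigr => b _; case: (b x).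
have sumA : \sum_(b in A) half_value L b E' = half_value L a E *+ #|A|.
  rewrite /half_value exchange_big /= -sumrMnl; apply: eq_bigr => x _.
  rewrite -mulr_sumr -mulrnAr; congr (_ * _); rewrite /half_point.
  case: (boolP (x \in E')) => xE'; first by rewrite (subsetP sE) // sumr_const.
  case: (boolP (x \in E)) => xE; first by rewrite -natr_sum halfA.
  by rewrite -sumr_const; apply: eq_bigr => b bA; rewrite (AE b).
suff /existsP[b /andP[bA fb]] : [exists b in A, falsified_at L b E'].
  exists b; split=> // [x|i]; first exact: AE.
  by move: bA; rewrite inE => /andP[_ /forallP/(_ i)/implyP h].
apply: contraT => /existsPn nA.
have : 2 * ineq_rhs L *+ #|A| <= half_value L a E *+ #|A|.
  rewrite -sumA -sumr_const; apply: ler_sum => b bA.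
  by have := nA b; rewrite bA /= -leNgt.
by rewrite lerMn2r eqn0Ngt A0 /= leNgt -/(falsified_at L a E) fa.
Qed.

End LinearSystem.

(** * From a falsified line to a falsified premise *)

Section Premise.
Variable n : nat.
Implicit Types (L : ineq n) (a b : assignment n) (E G : {set 'I_n}).

(** Values are doubled, so rounding moves a coordinate from 1 to 2 or 0. *)
Lemma half_value_round L a b E G :
  G \subset E -> (forall x, x \notin E -> b x = a x) ->
  half_value L b (E :\: G) =
    half_value L a E + \sum_(x in G) (-1) ^+ (~~ b x) * ineq_coef L 0 x.
Proof.
move=> sG ab; rewrite /half_value [X in _ + X]big_mkcond -big_split /=.
apply: eq_bigr => x _; rewrite /half_point inE.
case: (boolP (x \in G)) => xG /=; last first.
  by case: (boolP (x \in E)) => xE; rewrite addr0 // ab.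
rewrite (subsetP sG) //; case: (b x); rewrite /= ?expr1 ?expr0; lia.
Qed.

Lemma sat_ineqE L a : sat_ineq L a = ~~ falsified_at L a set0.
Proof.
rewrite /sat_ineq /falsified_at -leNgt /half_value.
under [X in _ = (_ <= X)]eq_bigr => x _ do
  rewrite /half_point inE natrM mulrCA.
by rewrite -mulr_sumr ler_pM2l.
Qed.

(** The all-half point is the midpoint of the all-0 and all-1 points, which both falsify [L]. *)
Lemma unsat_falsified_at L a :
  (forall b, ~~ sat_ineq L b) -> falsified_at L a setT.
Proof.
move=> unsat; pose b c : assignment n := [ffun=> c].
have roundb c : half_value L (b c) set0 =
    half_value L a setT + (-1) ^+ (~~ c) * \sum_(x in [set: 'I_n]) ineq_coef L 0 x.
  rewrite -(setDv setT) (half_value_round (a := a) _ (subxx _)); last by move=> x; rewrite inE.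
  by rewrite mulr_sumr; congr (_ + _); apply: eq_bigr => x _; rewrite ffunE.
have := unsat (b true); have := unsat (b false).
rewrite !sat_ineqE !negbK /falsified_at !roundb expr0 expr1; lia.
Qed.

(* By discrepancy, (a, E) can be rounded to a 0/1 point that loses nothing in the
   conclusion and at most half of \sum_(x in G) |coef x| in every premise; the
   same loss is achieved in a falsified premise by rounding G alone. *)
Lemma falsified_premise (P : sCP_dag n) (i : 'I_(nlines P)) a E :
  is_deduced i -> falsified_at (line i) a E ->
  exists j, exists b, exists G : {set 'I_n},
    [/\ j \in premises i, G \subset E, (#|G| <= 2)%N,
        forall x, x \notin E -> b x = a x & falsified_at (line j) b (E :\: G)].
Proof.
move=> [_ card_prem sound] fa.
pose v (q : 'I_#|premises i|) x := ineq_coef (line (enum_val q)) 0 x.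
have [eps [G [sG Gp disc]]] := discrepancy v E.
(* [s] negates all signs if needed so that the left-hand side of the conclusion does not increase;
   the discrepancy bounds are unaffected. *)
pose s := 0 < \sum_(x in E) (-1) ^+ eps x * ineq_coef (line i) 0 x.
pose b : assignment n := [ffun x => if x \in E then ~~ (eps x (+) s) else a x].
have ab x : x \notin E -> b x = a x by rewrite ffunE => /negPf->.
have roundb L : half_value L b set0 =
    half_value L a E + (-1) ^+ s * \sum_(x in E) (-1) ^+ eps x * ineq_coef L 0 x.
  rewrite -(setDv E) (half_value_round _ _ ab) // mulr_sumr; congr (_ + _).
  apply: eq_bigr => x xE; rewrite ffunE xE negbK signr_addb; ring.
have unsat_i : ~~ sat_ineq (line i) b.
  rewrite sat_ineqE negbK /falsified_at roundb; apply: le_lt_trans fa.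
  rewrite gerDl /s; case: ltP => h; rewrite ?expr1 ?expr0; lia.
have [j jP fj] : exists2 j, j \in premises i & falsified_at (line j) b set0.
  suff /existsP[j /andP[jP fj]] : [exists j in premises i, falsified_at (line j) b set0].
    by exists j.
  apply: contraNT unsat_i => /existsPn h; apply: sound => j jP.
  by have := h j; rewrite jP sat_ineqE.
pose l x := ineq_coef (line j) 0 x.
(* Each coordinate of [G] is rounded so as to decrease the left-hand side of premise [j]. *)
pose c : assignment n := [ffun x => if x \in G then l x < 0 else a x].
exists j, c, G; split=> //.
- exact: leq_trans Gp card_prem.
- move=> x xE; rewrite ffunE ifF //; apply: contraNF xE; exact: (subsetP sG).
have ac x : x \notin E -> c x = a x.
  by move=> xE; rewrite ffunE ifF //; apply: contraNF xE; exact: (subsetP sG).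
rewrite /falsified_at (half_value_round _ sG ac).
apply: le_lt_trans fj; rewrite roundb lerD2l.
have discj : `|\sum_(x in E) (-1) ^+ eps x * l x| <= \sum_(x in G) `|l x|.
  by have := disc (enum_rank_in jP j); rewrite /v enum_rankK_in.
have -> : \sum_(x in G) (-1) ^+ (~~ c x) * ineq_coef (line j) 0 x =
    - \sum_(x in G) `|l x|.
  rewrite -sumrN; apply: eq_bigr => x xG; rewrite ffunE xG -/(l x).
  by case: ltP => h; rewrite /= ?expr1 ?expr0; lia.
rewrite -[X in _ * X]/(\sum_(x in E) (-1) ^+ eps x * l x).
move: discj; rewrite ler_norml => /andP[].
by move: (\sum_(x in E) _) (\sum_(x in G) _) => S T; case: (s); rewrite ?expr1 ?expr0; lia.
Qed.

End Premise.

(** * Maximal sets of low boundary *)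

Section LowBoundary.
Variables (U V : finType) (e : U -> V -> bool) (r : nat).
Implicit Types (W : {set U}) (J : {set V}).

Definition low_boundary J W : bool :=
  (#|W| <= r)%N && (#|boundary e W :\: J| <= 3 * #|W|)%N.

Lemma low_boundaryS J J' W : J \subset J' -> low_boundary J W -> low_boundary J' W.
Proof.
move=> sJ /andP[Wr Wb]; rewrite /low_boundary Wr; apply: leq_trans Wb.
by rewrite subset_leq_card // setDS.
Qed.

(** Of at least [(s + 3) * #|W|] boundary vertices at most [3 * #|W|] lie outside [J]. *)
Lemma low_boundary_card (R : realType) (s : R) J W :
  boundary_expander e r (s + 3) -> low_boundary J W -> s * #|W|%:R <= #|J|%:R.
Proof.
move=> ex /andP[Wr Wb]; have [->|W0] := eqVneq W set0.
  by rewrite cards0 mulr0 ler0n.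
have := ex W W0 Wr; rewrite /boundary_expansion ler_pdivlMr ?ltr0n ?card_gt0 //.
have : (#|boundary e W| <= 3 * #|W| + #|J|)%N.
  rewrite -(cardsID J) addnC leq_add // subset_leq_card //; exact: subsetIr.
rewrite -(ler_nat R) natrD natrM; lra.
Qed.

(** Otherwise, by [boundaryU], [W :|: W'] would have low boundary too, against the maximality of
    [W]. *)
Lemma maxset_boundary J W W' :
  maxset (low_boundary J) W -> [disjoint W & W'] -> W' != set0 ->
  (#|W :|: W'| <= r)%N ->
  (3 * #|W'| < #|boundary e W' :\: (J :|: neighbours e W)|)%N.
Proof.
move=> maxW dW W'0 cardr; have /andP[_ lowW] := maxsetp maxW.
rewrite ltnNge; apply: contra W'0 => lowW'.
have cardWW' : #|W :|: W'| = (#|W| + #|W'|)%N by rewrite cardsU disjoint_setI0 // cards0 subn0.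
suff low : low_boundary J (W :|: W').
  have := maxsetsup maxW low (subsetUl _ _) => /(congr1 (fun A : {set U} => #|A|)).
  by rewrite cardWW' -cards_eq0; lia.
rewrite /low_boundary cardr cardWW' mulnDr; apply: leq_trans (leq_add lowW lowW').
apply: leq_trans (leq_card_setU _ _); rewrite subset_leq_card //.
apply: subset_trans (setSD _ (boundaryU _ _ _)) _.
by rewrite setDUl setDDl (setUC J).
Qed.

End LowBoundary.

(** * Walking back through the refutation *)

Section Depth.
Variables (m n : nat) (F : linsys m n) (r : nat).
Local Notation occ := (occurs F).
Local Notation bd := (boundary occ).
Implicit Types (J : {set 'I_n}) (W : {set 'I_m}).

Definition free_vars J W : {set 'I_n} := ~: (J :|: neighbours occ W).

(** Restores maximality after [J] has grown. Equations of [W] stay satisfied because their variables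
    are not free; [fix_solution] handles the new ones. *)
Lemma extend_closure (L : ineq n) J J' W a :
  maxset (low_boundary occ r J) W -> J \subset J' -> (#|J' :\: J| <= 2)%N ->
  (forall i, i \in W -> sat_eq F i a) ->
  falsified_at L a (free_vars J' W) ->
  exists W' b, [/\ maxset (low_boundary occ r J') W',
    forall i, i \in W' -> sat_eq F i b & falsified_at L b (free_vars J' W')].
Proof.
move=> maxW sJ cardJ satW fa.
have [W' maxW' sW] := maxset_exists (low_boundaryS sJ (maxsetp maxW)).
have [||b [ab satb fb]] := @fix_solution _ _ F L (W' :\: W) a _ (free_vars J' W') _ _ fa.
- by rewrite setCS setUS // neighboursS.
- move=> W2 sW2 W20; have W2W' := subset_trans sW2 (subsetDl _ _).
  have := @maxset_boundary _ _ _ _ _ _ W2 maxW.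
  have dW : [disjoint W & W2].
    rewrite disjoint_sym; apply: disjointWl sW2 _.
    by rewrite -setI_eq0 setIDAC setDIl setDv setI0.
  have cardW : (#|W :|: W2| <= r)%N.
    have /andP[Wr _] := maxsetp maxW'; apply: leq_trans Wr.
    by rewrite subset_leq_card // subUset sW.
  move=> /(_ dW W20 cardW) large; rewrite -card_gt0 in W20.
  have small : (#|bd W2 :\: (J :|: neighbours occ W)| <=
          #|bd W2 :&: free_vars J' W| + #|J' :\: J|)%N.
    apply: leq_trans (leq_card_setU _ _); rewrite subset_leq_card //.
    apply/subsetP => x; rewrite !inE !negb_or => /andP[/andP[xJ xN] xb].
    by rewrite xJ xN xb; case: (x \in J').
  (* More than [3 * #|W2|], hence at least four, boundary variables were available; [J'] removes at
     most two. *)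
  rewrite -(ltn_add2r 2); apply: leq_ltn_trans (leq_pmulr 3 W20) _.
  by apply: leq_trans large (leq_trans small _); rewrite leq_add2l.
exists W', b; split=> // i iW'.
case: (boolP (i \in W)) => iW; last by apply: satb; rewrite inE iW.
rewrite (@eq_sat_eq _ _ F i _ a) ?satW // => x ox; apply: ab.
rewrite inE negbK !inE; apply/orP; right; apply/existsP; exists i; exact/andP.
Qed.

(** Suppose [#|W| < r], and let [C] come from equation [i]. If [i] is in [W], some literal is
    integrally true and contributes 2 to the doubled value. Otherwise [[set i]] has at least four
    free boundary variables, each contributing 1. Either way [C] holds. *)
Lemma clause_falsified_card (C : clause n) J W a :
  C \in cnf_of F -> maxset (low_boundary occ r J) W ->
  (forall i, i \in W -> sat_eq F i a) ->
  falsified_at (ineq_of_clause C) a (free_vars J W) -> (r <= #|W|)%N.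
Proof.
rewrite inE => /existsP[i /existsP[c /andP[ci /eqP->]]] maxW satW.
apply: contraLR; rewrite -ltnNge => Wr; rewrite /falsified_at -leNgt.
set E := free_vars J W.
(* Twice the value of the literal of [x] in the clause. *)
pose t x : int := if occ i x then (if c x then 2 - half_point a E x else half_point a E x) else 0.
set C' := ruling_out F i c.
have valE : half_value (ineq_of_clause C') a E +
    2 * \sum_x ((x, false) \in C' : nat)%:R = \sum_x t x.
  rewrite mulr_sumr -big_split /=; apply: eq_bigr => x _.
  rewrite /t !mxE !inE /=.
  by case: (occ i x); case: (c x) => /=; lia.
have -> : ineq_rhs (ineq_of_clause C') = 1 - \sum_x ((x, false) \in C' : nat)%:R.
  rewrite /= -sum1_card natr_sum big_mkcond /=; congr (_ - _).
  by apply: eq_bigr => x _; rewrite inE; case: (_ \in _).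
rewrite mulrBr mulr1 lerBlDr valE.
have half01 x : 0 <= half_point a E x <= 2.
  by rewrite /half_point; case: ifP => // _; case: (a x).
have t0 x : 0 <= t x.
  by rewrite /t; case: ifP => // _; have := half01 x; case: (c x); lia.
case: (boolP (i \in W)) => iW.
  have [x ox acx] : exists2 x, occ i x & a x != c x.
    suff /existsP[x /andP[]] : [exists x, occ i x && (a x != c x)] by exists x.
    apply: contraNT ci => /existsPn h; rewrite (@eq_sat_eq _ _ F i _ a) ?satW // => x ox.
    apply/esym.
    by have := h x; rewrite ox /= negbK => /eqP.
  have xE : x \notin E.
    by rewrite !inE negbK; apply/orP; right; apply/existsP; exists i; exact/andP.
  rewrite (bigD1 x) //= -[X in X <= _]addr0 lerD ?sumr_ge0 //.
  rewrite /t ox /half_point (negPf xE).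
  by move: acx; case: (a x); case: (c x).
have dW : [disjoint W & [set i]] by rewrite disjoint_sym disjoints1.
have := @maxset_boundary _ _ _ _ _ _ [set i] maxW dW.
rewrite -card_gt0 cardsU (disjoint_setI0 dW) cards0 cards1 subn0 addn1.
move=> /(_ isT Wr) bdi.
set B := _ :\: _ in bdi.
have tB x : x \in B -> t x = 1.
  rewrite 3!inE => /andP[xE xb].
  have ox : occ i x.
    move: xb; rewrite inE => /eqP xb; have : (0 < #|neighbourhood occ x :&: [set i]|)%N by rewrite xb.
    by case/card_gt0P => u; rewrite !inE => /andP[ou /eqP <-].
  by rewrite /t ox /half_point !inE xE; case: (c x).
rewrite (bigID (mem B)) /= -[X in X <= _]addr0 lerD ?sumr_ge0 //.
rewrite (eq_bigr _ tB) sumr_const; lia.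
Qed.

Lemma leq_dag_depth (P : sCP_dag n) i (p : seq 'I_(nlines P)) :
  path (@dag_edge _ P) i p -> (size p < nlines P)%N -> (size p <= dag_depth P)%N.
Proof.
move=> pp sp; rewrite /dag_depth.
apply: (@leq_bigmax_cond _ _ _ (Ordinal sp)).
by apply/existsP; exists i; apply/existsP; exists (in_tuple p).
Qed.

(** Induction on the index of line [i], where [p] is the path already walked. Premises have smaller
    indices, so [i + size p < nlines P] persists and keeps [p] within the range of [dag_depth]. *)
Lemma falsified_line_depth (R : realType) (s : R) (P : sCP_dag n)
    (i : 'I_(nlines P)) (p : seq 'I_(nlines P)) J W a :
  linsys_expander F r (s + 3) -> 0 <= s -> sCP_proof P (cnf_of F) ->
  path (@dag_edge _ P) i p -> (i + size p < nlines P)%N ->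
  (#|J| <= 2 * size p)%N -> maxset (low_boundary occ r J) W ->
  (forall i, i \in W -> sat_eq F i a) ->
  falsified_at (line i) a (free_vars J W) ->
  r%:R * s / 2 <= (dag_depth P)%:R.
Proof.
move=> expF s0 proofP; have [k] := ubnP (i : nat).
elim: k i p J W a => // k IH i p J W a; rewrite ltnS => ik pathp sizep cardJ maxW satW fa.
have [[_ [C CF lineC]]|ded] := proofP i.
  rewrite lineC in fa; have rW := clause_falsified_card CF maxW satW fa.
  have sJ := low_boundary_card expF (maxsetp maxW).
  have pd : (size p <= dag_depth P)%N by apply: leq_dag_depth pathp _; lia.
  have rs : r%:R * s <= s * #|W|%:R by rewrite mulrC ler_wpM2l // ler_nat.
  have J2 : #|J|%:R <= 2 * (dag_depth P)%:R :> R.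
    by rewrite -natrM ler_nat; lia.
  by rewrite ler_pdivrMr //; lra.
have [j [b [G [jP sG cardG ab fb]]]] := falsified_premise ded fa.
have [ji _ _] := ded; have {}ji := ji j jP.
have satb l : l \in W -> sat_eq F l b.
  move=> lW; rewrite (@eq_sat_eq _ _ F l _ a) ?satW // => x ox; apply: ab.
  by rewrite !inE negbK; apply/orP; right; apply/existsP; exists l; exact/andP.
have EE : free_vars J W :\: G = free_vars (J :|: G) W.
  by rewrite /free_vars setDE -setCU setUAC.
rewrite EE in fb.
have cardJG : (#|(J :|: G) :\: J| <= 2)%N.
  apply: leq_trans cardG; rewrite subset_leq_card //.
  by apply/subsetP => x; rewrite !inE; case: (x \in J).
have [W' [c [maxW' satc fc]]] := extend_closure maxW (subsetUl J G) cardJG satb fb.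
apply: (IH j (i :: p) _ W' c _ _ _ _ maxW') => //=.
- exact: leq_trans ji ik.
- by rewrite pathp andbT.
- by lia.
- by apply: leq_trans (leq_card_setU _ _) _; lia.
Qed.

End Depth.

Theorem theorem5p8 (R : realType) (m n : nat) (F : linsys m n)
    (r : nat) (s : R) (expF : linsys_expander F r (s + 3)) :
  ((r%:R * s / 2)%:E <= depth_sCP R F)%E.
Proof.
apply: le_ereal_inf_tmp => _ [P [proofP [i unsat]] ->]; rewrite lee_fin.
have [s0|s0] := leP s 0.
  apply: (@le_trans _ _ 0); last exact: ler0n.
  by rewrite pmulr_lle0 ?invr_gt0 // mulr_ge0_le0.
have low0 : low_boundary (occurs F) r set0 set0.
  rewrite /low_boundary cards0 leq0n /= leqn0 cards_eq0 -subset0.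
  by apply/subsetP => x; rewrite !inE setI0 cards0 andbF.
have [W maxW _] := maxset_exists low0.
(* As [s > 0] and nothing is fixed yet, expansion makes the initial maximal set empty, so any
   assignment can start the walk. *)
have W0 : W = set0.
  have := low_boundary_card expF (maxsetp maxW).
  by rewrite cards0 pmulr_rle0 // lern0 cards_eq0 => /eqP.
pose a : assignment n := [ffun=> false].
apply: (falsified_line_depth (i := i) (p := [::]) (J := set0) (W := W) (a := a) expF) => //.
- exact: ltW.
- by rewrite addn0.
- by rewrite cards0.
- by move=> j; rewrite W0 inE.
rewrite W0 (_ : free_vars F set0 set0 = setT); first exact: unsat_falsified_at.
apply/setP => x; rewrite !inE; apply/existsPn => j; by rewrite inE.
Qed.
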